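(* Let $n$ be even and $m,\ell$ positive integers. For $i=1,\ldots,\ell$, let $\mu_i$ be a positive integer, $k_i=\lfloor\mu_im(n-1)/2\rfloor$, and assume $\mu_imK_n$ admits a 2-factorization of type $\mathcal{T}_i=[T_{i,1},\ldots,T_{i,k_i}]$. Let $\mathcal{O}=\{i:\mu_im(n-1)\text{ is odd}\}$ and let $\lambda$ be a positive integer. Then $\lambda K_{n\times m}$ admits a 2-factorization of type $$\bigsqcup_{i=1}^\ell[(mT_{i,1})^{\langle x_i\rangle},\ldots,(mT_{i,k_i})^{\langle x_i\rangle}]\ \sqcup\ [T_1,\ldots,T_{\lfloor\beta/2\rfloor}]$$ for all $(x_1,\ldots,x_\ell)\in\mathbb{N}^\ell$ with $\sum_{i=1}^\ell x_i\mu_i=\lambda$, where $\beta=\sum_{i\in\mathcal{O}}x_i$, and all admissible bipartite 2-factor types $T_1,\ldots,T_{\lfloor\beta/2\rfloor}$ for $2K_{n\times m}$ that are refinements of $[(2m)^{\langle n/2\rangle}]$.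
   Context: $\mu K_n$: complete multigraph on $n$ vertices with $\mu$ parallel edges per pair; $\lambda K_{n\times m}$: complete $\lambda$-fold $n$-partite multigraph with parts of size $m$. A 2-factor is a spanning 2-regular subgraph (2-cycles allowed); type $[c_1,\ldots,c_t]$ means a disjoint union of cycles of those lengths; $mT=[mx:x\in T]$. A 2-factorization of an $r$-regular graph is a decomposition into $\lfloor r/2\rfloor$ 2-factors plus a single 1-factor if $r$ is odd; its type is the multiset of types of its 2-factors. $[x^{\langle a\rangle}]$ denotes $a$ copies of $x$; $\sqcup$ is multiset union. A 2-factor type is bipartite if all entries are even, and admissible for a graph $\mathcal{G}$ if $\mathcal{G}$ contains a 2-factor of that type. A multiset $[y_1,\ldots,y_t]$ of positive integers is a refinement of $[x_1,\ldots,x_s]$ if $\{1,\ldots,t\}$ can be partitioned into sets $P_1,\ldots,P_s$ with $\sum_{j\in P_i}y_j=x_i$ for all $i$. *)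

(* Defs.v *)
From mathcomp Require Import all_boot.

Set Implicit Arguments.
Unset Strict Implicit.
Unset Printing Implicit Defensive.

(* Multisets, such as the type of a 2-factor, are represented by sequences;
   every predicate below depends on such a sequence only up to permutation. *)

(* A loopless multigraph on V: [mult G u v] is the number of parallel edges
   joining u and v.  Parallel edges are not distinguished, so a subgraph is a
   pointwise inequality of multiplicities and a decomposition is a pointwise
   sum of multiplicities. *)
Record mgraph (V : finType) := MGraph {
  mult : V -> V -> nat;
  mult_sym : forall u v, mult u v = mult v u;
  mult_irr : forall v, mult v v = 0
}.

Section Factors.
Variable V : finType.
Implicit Types (G H : mgraph V) (T : seq nat) (TT : seq (seq nat)).

Definition degree G (v : V) : nat := \sum_(u : V) mult G v u.

Definition regular (r : nat) G : Prop := forall v, degree G v = r.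

Definition subgraph H G : Prop := forall u v, mult H u v <= mult G u v.

(* Spanning, since H and G share the vertex type V. *)
Definition is_factor (k : nat) H G : Prop := subgraph H G /\ regular k H.

(* Multiplicity of the edge uv in the cycle visiting the distinct vertices
   listed in c, in cyclic order.  It is 2 on both pairs of a 2-cycle
   c = [:: a; b], as [next] then maps a to b and b to a. *)
Definition cycle_mult (c : seq V) (u v : V) : nat :=
  ((u \in c) && (next c u == v)) + ((v \in c) && (next c v == u)).

(* H is the union of vertex-disjoint cycles, covering V, whose lengths form
   the multiset T. *)
Definition has_type H T : Prop :=
  exists cs : seq (seq V),
    [/\ all (fun c => 2 <= size c) cs,
        perm_eq (flatten cs) (enum V),
        forall u v, mult H u v = \sum_(c <- cs) cycle_mult c u v
      & perm_eq [seq size c | c <- cs] T].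

Definition admissible G T : Prop :=
  exists H, is_factor 2 H G /\ has_type H T.

(* The 1-factor is indexed by 'I_(odd r), which has one element if r is odd
   and is empty otherwise. *)
Definition has_2factorization G TT : Prop :=
  exists r : nat,
    [/\ regular r G,
        size TT = r./2
      & exists (F : 'I_(size TT) -> mgraph V) (I : 'I_(odd r) -> mgraph V),
        [/\ forall j, is_factor 2 (F j) G,
            forall j, is_factor 1 (I j) G,
            forall u v, mult G u v =
              \sum_j mult (F j) u v + \sum_j mult (I j) u v
          & forall j, has_type (F j) (nth [::] TT j)]].

End Factors.

Lemma complete_mult_sym (V : finType) (mu : nat) (u v : V) :
  (if u != v then mu else 0) = (if v != u then mu else 0).
Proof. by rewrite eq_sym. Qed.

Lemma complete_mult_irr (V : finType) (mu : nat) (v : V) :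
  (if v != v then mu else 0) = 0.
Proof. by rewrite eqxx. Qed.

Definition complete_mgraph (mu n : nat) : mgraph 'I_n :=
  MGraph (complete_mult_sym mu) (@complete_mult_irr _ mu).

(* The parts are the fibres of the first projection. *)
Definition complete_multipartite (lambda n m : nat) :
    mgraph ('I_n * 'I_m)%type :=
  @MGraph ('I_n * 'I_m)%type
    (fun u v => if u.1 != v.1 then lambda else 0)
    (fun u v => complete_mult_sym lambda u.1 v.1)
    (fun v => complete_mult_irr lambda v.1).

Definition scale_type (m : nat) (T : seq nat) : seq nat := [seq m * x | x <- T].

Definition bipartite_type (T : seq nat) : bool := all (fun c => ~~ odd c) T.

(* The partition P_1, ..., P_s of the indices of ys is given by the map P
   sending each index to the number of its block. *)
Definition refinement (ys xs : seq nat) : Prop :=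
  all (fun y => 0 < y) ys /\
  exists P : 'I_(size ys) -> 'I_(size xs),
    forall i, \sum_(j | P j == i) nth 0 ys j = nth 0 xs i.

(* Main.v *)
Require Import Defs.
From mathcomp Require Import all_boot zify.

Set Implicit Arguments.
Unset Strict Implicit.
Unset Printing Implicit Defensive.

(* Amalgamation and detachment.  Walk m times around every cycle of every
   2-factor of mu m K_n, and take m copies of the 1-factor: this decomposes
   mu m^2 K_n into closed walks meeting each of their vertices m times.  Vertices
   are then split, one unit of weight at a time.  When x has weight p, a closed
   walk through x falls into p excursions from x, and it can be rerouted through
   a new vertex x' at any two half-edges of x lying on different excursions.
   Hall's theorem yields a choice of two such half-edges in each walk, and of one
   edge in the 1-factor, that takes exactly 1/p of the edges from x to every other
   vertex, so the edge multiplicities stay balanced.  At weight 1 the closed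
   walks are cycles mT in mu K_{n x m}, and what is left is a 1-factor over a
   1-factor of K_n.

   All these 1-factors are isomorphic by maps permuting the parts.  A bipartite
   2-factor type refining [2m, ..., 2m] is the union of two of them, so each copy
   of a factorization can be relabelled to leave any prescribed one of them, and
   the leaves pair up into T_1, ..., T_{beta/2}. *)

(** * Choosing half-edges by Hall's theorem *)

Section Hall.
Variables A B : finType.
Implicit Types (N : A -> {set B}) (X Y : {set A}).

Definition hall_condition N := [forall X : {set A}, #|X| <= #|\bigcup_(a in X) N a|].

(* Rado's argument: if neither [b1] nor [b2] can be removed from [N a], then by
   submodularity the union of two violating sets violates Hall for [N]. *)
Lemma hall_shrink N a b1 b2 :
  hall_condition N -> b1 \in N a -> b2 \in N a -> b1 != b2 ->
  exists2 b, b \in N a &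
    hall_condition (fun c => if c == a then N a :\ b else N c).
Proof.
move=> /forallP hN b1a b2a b12.
pose D b := fun c => if c == a then N a :\ b else N c.
case: (boolP (hall_condition (D b1))) => [h1|]; first by exists b1.
case: (boolP (hall_condition (D b2))) => [h2|]; first by exists b2.
rewrite !negb_forall => /existsP[X2 lt2] /existsP[X1 lt1].
(* Only the neighbourhood of [a] changes, so a set that violates the condition after the deletion
   must contain [a]. *)
have key b X : ~~ (#|X| <= #|\bigcup_(c in X) D b c|) ->
    a \in X /\ \bigcup_(c in X) D b c = (N a :\ b) :|: \bigcup_(c in X :\ a) N c.
  move=> lt; have aX : a \in X.
    apply: contraNT lt => aX; rewrite (eq_bigr N) ?hN // => c cX.
    by rewrite /D; case: eqP => // ec; rewrite ec (negPf aX) in cX.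
  split=> //; rewrite (big_setD1 a) //= {1}/D eqxx; congr (_ :|: _).
  by apply: eq_bigr => c; rewrite /D !inE => /andP[/negPf->].
have [aX1 e1] := key _ _ lt1; have [aX2 e2] := key _ _ lt2.
rewrite e1 -ltnNge in lt1; rewrite e2 -ltnNge in lt2.
set Y1 := X1 :\ a in e1 lt1; set Y2 := X2 :\ a in e2 lt2.
set U1 := (_ :|: _) in lt1; set U2 := (_ :|: _) in lt2.
(* Since [b1 != b2], the sets [N a :\ b1] and [N a :\ b2] together cover [N a]. *)
have s1 : \bigcup_(c in a |: (Y1 :|: Y2)) N c \subset U1 :|: U2.
  apply/bigcupsP => c; rewrite inE in_set1 => /orP[/eqP->|].
    apply/subsetP => b ba; rewrite /U1 /U2 !inE ba !andbT.
    by case: (eqVneq b b1) => [->|]; rewrite ?b12 ?orbT.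
  rewrite inE => /orP[] cY; apply/subsetP => b bc; rewrite inE.
    by apply/orP; left; rewrite inE; apply/orP; right; apply/bigcupP; exists c.
  by apply/orP; right; rewrite inE; apply/orP; right; apply/bigcupP; exists c.
have s2 : \bigcup_(c in Y1 :&: Y2) N c \subset U1 :&: U2.
  apply/bigcupsP => c /setIP[c1 c2]; apply/subsetP => b bc; rewrite inE.
  by apply/andP; split; rewrite inE; apply/orP; right; apply/bigcupP; exists c.
have := leq_trans (hN _) (subset_leq_card s1).
have := leq_trans (hN _) (subset_leq_card s2).
have := cardsUI U1 U2; have := cardsUI Y1 Y2.
have := cardsD1 a X1; have := cardsD1 a X2; rewrite aX1 aX2 -/Y1 -/Y2.
have aY : a \notin Y1 :|: Y2 by rewrite !inE eqxx.
have := cardsU1 a (Y1 :|: Y2); rewrite aY.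
lia.
Qed.

(** Induction on the total size of the sets [N a]: they are shrunk until each is a singleton, and
    then the condition on pairs makes the choice injective. *)
Lemma hall N : hall_condition N ->
  exists2 f : A -> B, injective f & forall a, f a \in N a.
Proof.
move: {2}(\sum_a #|N a|).+1 (ltnSn (\sum_a #|N a|)) => k.
elim: k => // k IH in N * => leN hN.
have ne a : exists b, b \in N a.
  apply/set0Pn; rewrite -card_gt0; move/forallP/(_ [set a]): hN.
  by rewrite cards1 big_set1.
case: (boolP [exists a, exists b1 in N a, exists b2 in N a, b1 != b2]).
  case/existsP=> a /exists_inP[b1 b1a /exists_inP[b2 b2a b12]].
  have [b ba hD] := hall_shrink hN b1a b2a b12.
  have [] := IH _ _ hD.
    rewrite -ltnS; apply: leq_trans leN; rewrite (bigD1 a) //= [X in _ < X.+1](bigD1 a) //= eqxx.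
    rewrite (cardsD1 b (N a)) ba -addSn.
    rewrite (eq_bigr (fun i => #|N i|)) // => i /negPf-> //.
  move=> f injf fD; exists f => // c; move: (fD c).
  by case: eqP => [->|//]; rewrite inE => /andP[].
move=> one; pose f a := xchoose (ne a).
have fN a : f a \in N a := xchooseP (ne a).
exists f => // a1 a2 e12; apply/eqP/negPn/negP => n12.
move/forallP/(_ [set a1; a2]): hN; rewrite cards2 n12 /= ltnNge => /negP[].
rewrite -(cards1 (f a1)) subset_leq_card //.
apply/bigcupsP => a a12; apply/subsetP => b ba; rewrite inE.
have -> : f a1 = f a by move: a12; rewrite !inE => /orP[] /eqP->.
apply: contraNT one => nb; apply/existsP; exists a.
by apply/exists_inP; exists b => //; apply/exists_inP; exists (f a).
Qed.

End Hall.

(** Read [M] as a bipartite multigraph and split each [b] into [N b] slots. A set [X] on the left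
    sends [p * #|X|] edges into its neighbourhood, which absorbs at most [p] per slot; this is
    Hall's condition. *)
Lemma biregular_matching (A B : finType) (M : A -> B -> nat) (p : nat) (N : B -> nat) :
  0 < p -> (forall a, \sum_b M a b = p) -> (forall b, \sum_a M a b = p * N b) ->
  exists f : A -> B,
    (forall a, 0 < M a (f a)) /\ (forall b, \sum_a (f a == b) = N b).
Proof.
move=> p0 rowM colM; pose Slot := {b : B & 'I_(N b)}.
have sum_slots (F : B -> nat) : \sum_(s : Slot) F (tag s) = \sum_b F b * N b.
  rewrite -(sig_big_dep (fun _ : B => true) (fun b (_ : 'I_(N b)) => true) (fun b _ => F b)).
  by apply: eq_bigr => b _; rewrite sum_nat_const card_ord mulnC.
pose E a := [set s : Slot | 0 < M a (tag s)].
have [|f injf fE] := @hall A Slot E.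
  apply/forallP => X; pose h b := [exists a in X, 0 < M a b].
  have -> : #|\bigcup_(a in X) E a| = \sum_b h b * N b.
    rewrite -(sum_slots (fun b => h b : nat)) -sum1_card big_mkcond /=.
    apply: eq_bigr => s _; rewrite /h; case: bigcupP.
      case=> a aX; rewrite inE => Ma.
      by have -> : [exists a in X, 0 < M a (tag s)] by apply/exists_inP; exists a.
    case: exists_inP => // -[a aX Ma] [].
    by exists a => //; rewrite inE.
  rewrite -(leq_pmul2r p0) -sum_nat_const -(eq_bigr _ (fun a _ => rowM a)).
  rewrite exchange_big big_distrl /=; apply: leq_sum => b _.
  rewrite -mulnA [N b * p]mulnC -colM; case: (boolP (h b)) => [_|].
    by rewrite mul1n big_mkcond; apply: leq_sum => a _; case: ifP.
  rewrite negb_exists_in => /forall_inP hb; rewrite big1 // => a aX.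
  by apply/eqP; rewrite -leqn0 leqNgt hb.
exists (fun a => tag (f a)); split=> [a|]; first by have := fE a; rewrite inE.
(* Injectivity into the slots only bounds each fibre from above; both sides have the same total, so
   every bound is attained. *)
have le b : \sum_a (tag (f a) == b) <= N b.
  rewrite -[X in _ <= X](_ : \sum_(s : Slot) (tag s == b) = N b); last first.
    rewrite (sum_slots (fun c => c == b : nat)) (bigD1 b) //= eqxx mul1n.
    by rewrite big1 ?addn0 // => c /negPf->.
  rewrite -(big_imset (fun s => (tag s == b) : nat)) /=; last by move=> ? ? _ _ /injf.
  by rewrite [X in _ <= X](bigID (mem [set f x | x in A])) leq_addr.
have eq_tot : \sum_b \sum_a (tag (f a) == b) = \sum_b N b.
  apply/eqP; rewrite -(eqn_pmul2l p0) [X in _ == X]big_distrr /=.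
  rewrite -[X in _ == X](eq_bigr _ (fun b _ => colM b)).
  rewrite exchange_big [X in _ == X]exchange_big big_distrr /=.
  apply/eqP/eq_bigr => a _; rewrite rowM (bigD1 (tag (f a))) //= eqxx.
  by rewrite big1 ?addn0 ?muln1 // => b /negPf; rewrite eq_sym => ->.
have [_] := leqif_sum (fun b (_ : true) => leqif_eq (le b)).
by rewrite eq_tot eqxx => /esym/forallP h b; apply/eqP/h.
Qed.

Lemma sum_eql (T : finType) (t : T) : \sum_(u : T) (t == u) = 1.
Proof. by rewrite (bigD1 t) //= eqxx big1 // => u /negPf; rewrite eq_sym => ->. Qed.

Lemma sum_eqr (T : finType) (t : T) : \sum_(u : T) (u == t) = 1.
Proof. by rewrite -[RHS](sum_eql t); apply: eq_bigr => u _; rewrite eq_sym. Qed.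

(* Each block [(k, i)] must use one of its ends [a k i], [b k i] or its private
   dummy [(k, i)]; two auxiliary vertices per [k] take two of these dummies, so
   exactly two blocks of [k] use an end.  All degrees equal [p]. *)
Lemma select_ends (V K L : finType) (p : nat) (a b : K -> 'I_p -> V)
    (G : L -> V -> nat) (N : V -> nat) :
  1 < p ->
  (forall l, \sum_y G l y = p) ->
  (forall y, \sum_k \sum_i ((a k i == y) + (b k i == y)) + \sum_l G l y = p * N y) ->
  exists (i1 i2 : K -> 'I_p) (y1 y2 : K -> V) (z : L -> V),
    [/\ forall k, [/\ i1 k != i2 k, (y1 k == a k (i1 k)) || (y1 k == b k (i1 k))
                     & (y2 k == a k (i2 k)) || (y2 k == b k (i2 k))],
        forall l, 0 < G l (z l)
      & forall y, \sum_k ((y1 k == y) + (y2 k == y)) + \sum_l (z l == y) = N y].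
Proof.
move=> p1 rowG colN.
pose A : Type := (K * 'I_p + K * bool + L)%type.
pose B : Type := (K * 'I_p + V)%type.
(* A block puts weight [p.-2] on its dummy and 1 on each of its two ends; an auxiliary vertex puts 1
   on each of the [p] dummies of its [k]. A dummy thus receives [p.-2] plus 2. *)
pose M (x : A) (y : B) : nat := match x, y with
  | inl (inl ki), inl ki' => (ki == ki') * p.-2
  | inl (inl ki), inr v => (a ki.1 ki.2 == v) + (b ki.1 ki.2 == v)
  | inl (inr ks), inl ki => ks.1 == ki.1
  | inl (inr _), inr _ => 0
  | inr l, inl _ => 0
  | inr l, inr v => G l v end.
pose NB (y : B) : nat := if y is inr v then N v else 1.
have [|x|y|f [fM fN]] := @biregular_matching A B M p NB; first exact: ltnW.
- rewrite /B big_sumType /=; case: x => [[ki|ks]|l] /=.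
  + rewrite big_split /= !sum_eql -big_distrl /=.
    rewrite (bigD1 ki) //= eqxx big1 ?addn0 ?mul1n; first by lia.
    by move=> kj /negPf; rewrite eq_sym => ->.
  + rewrite big1_eq addn0 -(pair_big xpredT xpredT (fun k (i : 'I_p) => ks.1 == k : nat)) /=.
    under eq_bigr => k _ do rewrite sum_nat_const card_ord.
    by rewrite -big_distrr /= sum_eql muln1.
  + by rewrite big1_eq rowG.
- rewrite /A !big_sumType /=; case: y => [ki|v] /=.
  + rewrite [X in _ + X]big1_eq addn0 -big_distrl /= sum_eqr.
    rewrite -(pair_big xpredT xpredT (fun k (_ : bool) => k == ki.1 : nat)) /=.
    under eq_bigr => k _ do rewrite sum_nat_const card_bool.
    by rewrite -big_distrr /= sum_eqr; lia.
  + rewrite big1_eq addn0 -colN; congr (_ + _).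
    by rewrite (pair_big xpredT xpredT
                  (fun k i => (a k i == v) + (b k i == v))).
pose blk (k : K) (i : 'I_p) : A := inl (inl (k, i)).
have oE (ks : K * bool) : exists i : 'I_p, f (inl (inr ks)) == inl (ks.1, i).
  have := fM (inl (inr ks)); case: (f _) => [[k i]|v] //=.
  by case: eqP => // -> _; exists i.
pose o (k : K) (s : bool) : 'I_p := xchoose (oE (k, s)).
have fo (k : K) (s : bool) : f (inl (inr (k, s))) = inl (k, o k s) := eqP (xchooseP (oE (k, s))).
have fblk (k : K) (i : 'I_p) : f (blk k i) = inl (k, i) \/
    exists2 v, f (blk k i) = inr v & (v == a k i) || (v == b k i).
  have := fM (blk k i); case: (f _) => [ki|v] /=.
    by case: eqP => // ->; left.
  by rewrite addn_gt0 !lt0b ![_ == v]eq_sym => h; right; exists v.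
(* A dummy has capacity 1: it is taken either by its own block or by exactly one of the two
   auxiliary vertices of [k]. *)
have dummy (k : K) (i : 'I_p) :
    (f (blk k i) == inl (k, i)) + (o k true == i) + (o k false == i) = 1.
  have := fN (inl (k, i)); rewrite /A !big_sumType /= => <-.
  rewrite [X in _ = _ + _ + X]big1 ?addn0; last first.
    by move=> l _; have := fM (inr l); case: (f _).
  rewrite -addnA; congr (_ + _).
    rewrite (bigD1 (k, i)) //= big1 ?addn0 // => kj.
    case: (fblk kj.1 kj.2); rewrite /blk -surjective_pairing.
      by move=> -> /negPf; rewrite (inj_eq inl_inj) => ->.
    by case=> v ->.
  rewrite (bigD1 (k, true)) //= (bigD1 (k, false)) ?xpair_eqE ?eqxx //= !fo !(inj_eq inl_inj).
  rewrite !xpair_eqE !eqxx /= big1 ?addn0 // => -[k' s]; rewrite !xpair_eqE.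
  rewrite fo (inj_eq inl_inj) xpair_eqE.
  by case: (k' == k) => //; case: s.
(* The fallback value is never reached: an auxiliary vertex takes the dummy of block [o k s], so
   this block is matched to one of its ends. *)
pose y (k : K) (s : bool) : V := if f (blk k (o k s)) is inr v then v else a k (o k s).
have fy (k : K) (s : bool) : f (blk k (o k s)) = inr (y k s) /\
    ((y k s == a k (o k s)) || (y k s == b k (o k s))).
  rewrite /y; have := dummy k (o k s).
  case: (fblk k (o k s)) => [->|[v -> h //]].
  by rewrite eqxx; case: s; rewrite eqxx; lia.
have zE (l : L) : exists v, f (inr l) == inr v.
  by have := fM (inr l); case: (f _) => // v _; exists v.
pose z (l : L) : V := xchoose (zE l).
have fz (l : L) : f (inr l) = inr (z l) := eqP (xchooseP (zE l)).
have o12 k : o k true != o k false.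
  by apply/eqP => e; have := dummy k (o k true); rewrite -e eqxx; lia.
exists (o^~ true), (o^~ false), (y^~ true), (y^~ false), z; split.
- by move=> k; split=> //; [case: (fy k true) | case: (fy k false)].
- by move=> l; have := fM (inr l); rewrite fz.
move=> v; have := fN (inr v); rewrite /A !big_sumType /= => <-.
rewrite [X in _ = _ + X + _]big1 ?addn0; last by move=> [k s] _; rewrite fo.
congr (_ + _); last by apply: eq_bigr => l _; rewrite fz (inj_eq inr_inj).
rewrite (eq_bigr (fun ki => (f (blk ki.1 ki.2) == inr v) : nat)); last by case.
rewrite -(pair_big xpredT xpredT (fun k i => (f (blk k i) == inr v) : nat)) /=.
apply: eq_bigr => k _; rewrite (bigD1 (o k true)) //=.
rewrite (bigD1 (o k false)) /=; last by rewrite eq_sym.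
rewrite !(fy k _).1 !(inj_eq inr_inj) big1 ?addn0 // => i /andP[n1 n2].
have := dummy k i; rewrite ![_ == i]eq_sym (negPf n1) (negPf n2) !addn0.
by case: eqP => // ->.
Qed.

(** * Closed walks and their excursions *)

Section Walks.
Variable V : eqType.
Implicit Types (a b u v x y : V) (s w : seq V) (ss : seq (seq V)).

(** A loop counts 2 at its vertex, so that row sums are degrees. *)
Definition edge_mult a b u v : nat :=
  ((a == u) && (b == v)) + ((a == v) && (b == u)).

Fixpoint path_mult a s u v : nat :=
  if s is b :: s' then edge_mult a b u v + path_mult b s' u v else 0.

Definition walk_mult w u v : nat :=
  if w is a :: s then path_mult a (rcons s a) u v else 0.

Lemma edge_multC a b u v : edge_mult a b u v = edge_mult b a u v.
Proof. by rewrite /edge_mult addnC andbC [(a == u) && _]andbC. Qed.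

Lemma edge_mult_sym a b u v : edge_mult a b u v = edge_mult a b v u.
Proof. exact: addnC. Qed.

Lemma path_mult_cat a s1 s2 u v :
  path_mult a (s1 ++ s2) u v = path_mult a s1 u v + path_mult (last a s1) s2 u v.
Proof. by elim: s1 a => //= b s1 IH a; rewrite IH addnA. Qed.

Lemma path_mult_rcons a s b u v :
  path_mult a (rcons s b) u v = path_mult a s u v + edge_mult (last a s) b u v.
Proof. by rewrite -cats1 path_mult_cat /= addn0. Qed.

Lemma path_mult_sym a s u v : path_mult a s u v = path_mult a s v u.
Proof. by elim: s a => //= b s IH a; rewrite IH edge_mult_sym. Qed.

Lemma walk_mult_sym w u v : walk_mult w u v = walk_mult w v u.
Proof. by case: w => //= a s; exact: path_mult_sym. Qed.

Lemma path_mult_rev a s b u v :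
  path_mult b (rcons (rev s) a) u v = path_mult a (rcons s b) u v.
Proof.
elim: s a b => [|c s IH] a b; first by rewrite /= edge_multC.
by rewrite rev_cons path_mult_rcons IH last_rcons /= edge_multC addnC.
Qed.

Lemma walk_mult_rot1 w u v : walk_mult (rot 1 w) u v = walk_mult w u v.
Proof.
case: w => [|a [|b s]] //; rewrite /rot /= ?drop0 ?take0 cats1.
by rewrite path_mult_rcons last_rcons [RHS]addnC.
Qed.

Lemma walk_mult_rot k w u v : walk_mult (rot k w) u v = walk_mult w u v.
Proof.
have [kw|kw] := leqP k (size w); last by rewrite rot_oversize 1?ltnW.
elim: k kw => [|k IH] kw; first by rewrite rot0.
by rewrite -add1n rotD // walk_mult_rot1 IH // ltnW.
Qed.

(** The closed walk that visits [x] once before each list of [ss]; the lists are the stretches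
    between successive visits. *)
Definition excursions x ss : seq V := flatten [seq x :: s | s <- ss].

Lemma path_mult_excursions x ss u v :
  path_mult x (behead (rcons (excursions x ss) x)) u v =
  \sum_(s <- ss) path_mult x (rcons s x) u v.
Proof.
elim: ss => [|s ss IH]; rewrite ?big_nil // big_cons -IH.
case: ss {IH} => [|s' ss]; first by rewrite /excursions /= cats0 addn0.
have -> : excursions x [:: s, s' & ss] = x :: s ++ excursions x (s' :: ss) by [].
rewrite rcons_cons [behead _]/= rcons_cat path_mult_cat.
rewrite [path_mult x (rcons s x) u v]path_mult_rcons.
by rewrite {1}[excursions x (s' :: ss)]/= rcons_cons /= addnA.
Qed.

Lemma walk_mult_excursions x ss u v :
  walk_mult (excursions x ss) u v = \sum_(s <- ss) path_mult x (rcons s x) u v.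
Proof. by rewrite -path_mult_excursions; case: ss. Qed.

(** The walk is rotated to start at a visit of [x] and cut at every visit; rotation changes neither
    its edges nor its visits. *)
Lemma excursionsP w x : x \in w ->
  exists ss,
    [/\ perm_eq w (excursions x ss), walk_mult w =2 walk_mult (excursions x ss),
        size ss = count_mem x w & forall s, s \in ss -> x \notin s].
Proof.
move=> xw; have split t : exists s ss, [/\ t = s ++ excursions x ss, x \notin s,
    size ss = count_mem x t & forall s', s' \in ss -> x \notin s'].
  elim: t => [|y t [s [ss [-> xs szss nss]]]]; first by exists [::], [::].
  have [->|ne] := eqVneq y x.
    exists [::], (s :: ss); split=> //=; first by rewrite szss eqxx.
    by move=> s'; rewrite inE => /orP[/eqP->|/nss].
  exists (y :: s), ss; split=> //=; first by rewrite inE negb_or eq_sym ne.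
  by rewrite (negPf ne).
have [s [ss [def_t xs szss nss]]] := split (behead (rot (index x w) w)).
have def_w : rot (index x w) w = excursions x (s :: ss).
  move: def_t; rewrite /rot (drop_nth x) ?index_mem // nth_index //= => ->.
  by [].
exists (s :: ss); split.
- by rewrite -def_w perm_sym perm_rot.
- by move=> u v; rewrite -def_w walk_mult_rot.
- have /permP-> : perm_eq w (rot (index x w) w) by rewrite perm_sym perm_rot.
  by rewrite /= szss def_w /= eqxx.
- by move=> s'; rewrite inE => /orP[/eqP->|/nss].
Qed.

Lemma count_excursions x ss z :
  count_mem z (excursions x ss) = \sum_(s <- ss) ((x == z) + count_mem z s).
Proof.
elim: ss => [|s ss IH]; first by rewrite big_nil.
by rewrite big_cons -IH /= count_cat addnA.
Qed.

(** As [x] does not occur inside an excursion, the edges of the walk at [x] are the first and last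
    edges of the excursions. A one-vertex excursion contributes its edge twice. *)
Lemma count_excursion_ends x ss y : x != y ->
  (forall s, s \in ss -> x \notin s) -> (forall s, s \in ss -> s != [::]) ->
  walk_mult (excursions x ss) x y =
  \sum_(s <- ss) ((head x s == y) + (last x s == y)).
Proof.
move=> xy nss ness; rewrite walk_mult_excursions; apply: eq_big_seq => s sss.
have := nss s sss; have := ness s sss; case: s {sss} => //= a s _.
move=> xas; have lx : last a s == x = false.
  by apply: contraNF xas => /eqP <-; exact: mem_last.
rewrite path_mult_rcons /edge_mult !eqxx (negPf xy) lx /= addn0 andbT add0n.
move: xas {lx}; rewrite inE negb_or => /andP[xa xs]; rewrite addnCA addnA.
suff -> : path_mult a s x y = 0 by [].
elim: s a xa xs => //= b s IH a xa; rewrite inE negb_or => /andP[xb xs].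
by rewrite IH // /edge_mult ![_ == x]eq_sym (negPf xa) (negPf xb) andbF.
Qed.

(* The excursions can be permuted and reversed, so that the two chosen ends meet
   at one visit of [x], which is then replaced by [x']. *)
Lemma reroute x x' ss i1 i2 y1 y2 :
  i1 < size ss -> i2 < size ss -> i1 != i2 ->
  (y1 == head x (nth [::] ss i1)) || (y1 == last x (nth [::] ss i1)) ->
  (y2 == head x (nth [::] ss i2)) || (y2 == last x (nth [::] ss i2)) ->
  exists w,
    (forall z, count_mem z w + (x == z) = count_mem z (excursions x ss) + (x' == z)) /\
    (forall u v, walk_mult w u v + (edge_mult x y1 u v + edge_mult x y2 u v) =
       walk_mult (excursions x ss) u v + (edge_mult x' y1 u v + edge_mult x' y2 u v)).
Proof.
move=> lt1 lt2 ne12 end1 end2.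
set s1 := nth _ _ i1 in end1; set s2 := nth _ _ i2 in end2.
(* Permuting positions instead of elements keeps two equal excursions apart. *)
have [rest perm_ss] : exists rest, perm_eq ss [:: s1, s2 & rest].
  exists [seq nth [::] ss i | i <- rem i2 (rem i1 (iota 0 (size ss)))].
  rewrite -{1}[ss](mkseq_nth [::]) /mkseq.
  rewrite (perm_map (nth [::] ss) (t := [:: i1, i2 & rem i2 (rem i1 (iota 0 (size ss)))])) //.
  have m1 : i1 \in iota 0 (size ss) by rewrite mem_iota.
  rewrite (perm_trans (perm_to_rem m1)) // perm_cons perm_to_rem //.
  by rewrite rem_filter ?iota_uniq // mem_filter /= eq_sym ne12 mem_iota.
have last_rev s : last x (rev s) = head x s.
  by case: s => //= a s; rewrite rev_cons last_rcons.
have [t1 [lt1' ct1 pt1]] : exists t, [/\ last x t = y1, perm_eq t s1 &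
    forall u v, path_mult x (rcons t x) u v = path_mult x (rcons s1 x) u v].
  case/orP: end1 => /eqP->; last by exists s1.
  exists (rev s1); split=> [||u v]; [exact: last_rev | exact: permEl (perm_rev _) |].
  exact: path_mult_rev.
have [t2 [ht2 ct2 pt2]] : exists t, [/\ head x t = y2, perm_eq t s2 &
    forall u v, path_mult x (rcons t x) u v = path_mult x (rcons s2 x) u v].
  case/orP: end2 => /eqP->; first by exists s2.
  exists (rev s2); split=> [||u v]; [| exact: permEl (perm_rev _) | exact: path_mult_rev].
  by rewrite -last_rev revK.
(* [t1] ends at [y1] and [t2] starts at [y2], so the visit between them carries exactly the two
   chosen edges; [x'] takes the place of [x] there. *)
exists (x :: t1 ++ x' :: t2 ++ excursions x rest); split=> [z|u v].
  rewrite count_excursions (perm_big _ perm_ss) !big_cons /= -count_excursions.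
  by rewrite count_cat /= count_cat -(permP ct1) -(permP ct2) /=; lia.
rewrite walk_mult_excursions (perm_big _ perm_ss) !big_cons /=.
rewrite -path_mult_excursions -pt1 -pt2 rcons_cat path_mult_cat rcons_cons /=.
rewrite rcons_cat path_mult_rcons lt1' -ht2.
have -> : rcons (excursions x rest) x = x :: behead (rcons (excursions x rest) x).
  by case: rest {perm_ss}.
rewrite -cat_rcons path_mult_cat last_rcons.
case: t2 {ct2 pt2 ht2} => [|a t2] /=; first by rewrite ![edge_mult _ y1 _ _]edge_multC; lia.
by rewrite ![edge_mult _ y1 _ _]edge_multC; lia.
Qed.

End Walks.

(** * Vertex splitting *)

Lemma path_mult_notin (V : eqType) (x a : V) s y :
  x \notin a :: s -> path_mult a s x y = 0.
Proof.
elim: s a => //= b s IH a; rewrite !inE !negb_or => /and3P[xa xb xs].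
rewrite IH ?inE ?negb_or ?xb // /edge_mult ![_ == x]eq_sym.
by rewrite (negPf xa) (negPf xb) andbF.
Qed.

Lemma walk_mult_notin (V : eqType) (x : V) w y : x \notin w -> walk_mult w x y = 0.
Proof.
case: w => //= a s nx; apply: path_mult_notin.
by move: nx; rewrite !inE mem_rcons inE !negb_or => /andP[-> ->].
Qed.

Lemma sum_edge_mult (V : finType) (a b u : V) :
  \sum_v edge_mult a b u v = (a == u) + (b == u).
Proof.
rewrite big_split /=; congr (_ + _).
  case: (a == u); last by rewrite big1.
  by rewrite -[RHS](sum_eql b); apply: eq_bigr.
case: (b == u); last by rewrite big1 // => v _; rewrite andbF.
by rewrite -[RHS](sum_eql a); apply: eq_bigr => v _; rewrite andbT.
Qed.

Section Splitting.
Variables (V : finType) (U : eqType) (part : V -> U) (K L : finType).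
(** Data of the base graph on [U]: [S k u] says that the [k]-th cycle passes through [u], and [R l]
    is adjacency in the [l]-th 1-factor. *)
Variables (S : K -> U -> bool) (R : L -> U -> U -> bool) (mu : nat).

(* The vertex [x] stands for [wt x] vertices still to be split off; the closed
   walks [W k] become cycles, and the graphs [G l] 1-factors, once [wt] is 1. *)
Record amalgam (wt : V -> nat) (W : K -> seq V) (G : L -> V -> V -> nat) : Prop := {
  amalgam_count k x : count_mem x (W k) = S k (part x) * wt x;
  amalgam_sym l x y : G l x y = G l y x;
  amalgam_deg l x : \sum_y G l x y = wt x;
  amalgam_supp l x y : 0 < G l x y -> R l (part x) (part y);
  amalgam_total x y : \sum_k walk_mult (W k) x y + \sum_l G l x y =
                      (part x != part y) * (mu * wt x * wt y) }.

Lemma split_vertex wt W G x x' :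
  amalgam wt W G -> part x = part x' -> 1 < wt x -> wt x' = 0 ->
  exists W' G', amalgam (fun z => wt z - (x == z) + (x' == z)) W' G'.
Proof.
move=> [cntW symG degG suppG tot] pxx' wx wx'.
have nxx' : x != x' by apply: contraTneq wx => ->; rewrite wx'.
(* Only the walks over cycles through [part x] are rerouted; each of them visits [x] exactly [wt x]
   times. *)
pose KS := {k : K | S k (part x)}.
have cntKS (k : KS) : count_mem x (W (val k)) = wt x.
  by rewrite cntW (valP k) mul1n.
have /fin_all_exists[ss ssP] (k : KS) : exists ss,
    [/\ perm_eq (W (val k)) (excursions x ss),
        walk_mult (W (val k)) =2 walk_mult (excursions x ss),
        size ss = wt x & forall s, s \in ss -> x \notin s].
  have [|ss [h1 h2 h3 h4]] := @excursionsP _ (W (val k)) x.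
    by rewrite -has_pred1 has_count cntKS ltnW.
  by exists ss; split=> //; rewrite h3 cntKS.
have tot0 y : part x = part y -> (forall k, walk_mult (W k) x y = 0) /\ (forall l, G l x y = 0).
  move=> pxy; have := tot x y; rewrite pxy eqxx mul0n => /eqP.
  rewrite addn_eq0 !sum_nat_eq0 => /andP[/forall_inP h1 /forall_inP h2].
  by split=> [k|l]; apply/eqP; [apply: h1 | apply: h2].
(* An empty excursion would be a loop at [x], but no edge joins vertices of the same part. *)
have ness (k : KS) s : s \in ss k -> s != [::].
  apply: contraTneq => ->; apply/negP => nilss.
  have [_ wm _ _] := ssP k; have := (tot0 x erefl).1 (val k).
  rewrite wm walk_mult_excursions (big_rem _ nilss) /=.
  by rewrite /edge_mult !eqxx.
pose N y := (part x != part y) * (mu * wt y).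
pose a (k : KS) (i : 'I_(wt x)) := head x (nth [::] (ss k) i).
pose b (k : KS) (i : 'I_(wt x)) := last x (nth [::] (ss k) i).
have [||i1 [i2 [y1 [y2 [z [sel selG selN]]]]]] :=
    @select_ends V KS L (wt x) a b (fun l => G l x) N wx.
- by move=> l; rewrite degG.
- move=> y.
  have -> : \sum_k \sum_i ((a k i == y) + (b k i == y)) =
            \sum_k \sum_(s <- ss k) ((head x s == y) + (last x s == y)).
    apply: eq_bigr => k _; have [_ _ szk _] := ssP k.
    by rewrite (big_nth [::]) szk big_mkord.
  have [<-|xy] := eqVneq x y.
    rewrite /N eqxx mul0n muln0 !big1 // => [l _|k _]; first exact: (tot0 x erefl).2.
    rewrite big_seq big1 // => s sss; have [_ _ _ /(_ s sss)] := ssP k.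
    have := ness k s sss; case: s {sss} => //= c s _ nx.
    have -> : c == x = false by apply: contraNF nx => /eqP ->; exact: mem_head.
    by have -> : last c s == x = false by apply: contraNF nx => /eqP <-; exact: mem_last.
  have -> : wt x * N y = (part x != part y) * (mu * wt x * wt y) by rewrite /N; lia.
  rewrite -tot; congr (_ + _).
  rewrite [RHS](bigID (fun k => S k (part x))) /= [X in _ = _ + X]big1 ?addn0; last first.
    move=> k nSk; apply: walk_mult_notin.
    by rewrite -has_pred1 has_count cntW (negPf nSk).
  rewrite (big_sub (fun k => S k (part x)) (fun k => walk_mult (W k) x y)).
  apply: eq_bigr => k _; have [_ -> _ nss] := ssP k.
  by rewrite count_excursion_ends // => s; exact: ness.
have /fin_all_exists[w wP] (k : KS) : exists w,
    (forall u, count_mem u w + (x == u) = count_mem u (W (val k)) + (x' == u)) /\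
    (forall u v, walk_mult w u v + (edge_mult x (y1 k) u v + edge_mult x (y2 k) u v) =
       walk_mult (W (val k)) u v + (edge_mult x' (y1 k) u v + edge_mult x' (y2 k) u v)).
  have [ne12 e1 e2] := sel k; have [pk wk szk nk] := ssP k.
  have [||w [w1 w2]] := @reroute _ x x' (ss k) (i1 k) (i2 k) (y1 k) (y2 k) _ _ ne12 e1 e2.
  - by rewrite szk.
  - by rewrite szk.
  by exists w; split=> [u|u v]; rewrite ?w1 ?w2 ?wk ?(permP pk).
pose W' k := if insub k is Some k' then w k' else W k.
(* The chosen edge from [x] to [z l] now starts at [x']; by [leG] below the truncated subtraction is
   exact. *)
pose G' l u v := G l u v - edge_mult x (z l) u v + edge_mult x' (z l) u v.
have pz l : part x != part (z l).
  by apply: contraTneq (selG l) => /tot0[_ ->].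
have leG l u v : edge_mult x (z l) u v <= G l u v.
  have xz : x != z l by apply: contraNneq (pz l) => <-.
  have Gxz := selG l; have Gzx : 0 < G l (z l) x by rewrite symG.
  rewrite /edge_mult; case: (eqVneq x u) => [<-|_] /=.
    by rewrite [z l == x]eq_sym (negPf xz) andbF addn0; case: eqP => [<-|].
  by rewrite add0n; case: (eqVneq x v) => [<-|] //=; case: eqP => [<-|].
have G'E l u v : G' l u v + edge_mult x (z l) u v = G l u v + edge_mult x' (z l) u v.
  by rewrite /G'; have := leG l u v; lia.
exists W', G'; split.
- move=> k u; rewrite /W'; case: insubP => [k' Sk <-|nSk].
    have := (wP k').1 u; rewrite cntW; move: (valP k') => /=.
    case: eqP => [<- ->|_ Sk']; first by rewrite [x' == x]eq_sym (negPf nxx'); lia.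
    case: eqP => [<-|_]; first by rewrite -pxx' Sk' wx'; lia.
    lia.
  rewrite cntW; case: eqP => [<-|_]; first by rewrite (negPf nSk).
  by case: eqP => [<-|_]; rewrite ?subn0 ?addn0 // -pxx' (negPf nSk).
- by move=> l u v; rewrite /G' symG ![edge_mult _ _ u v]edge_mult_sym.
- move=> l u; have : \sum_v G' l u v + ((x == u) + (z l == u)) =
                     wt u + ((x' == u) + (z l == u)).
    by rewrite -(degG l) -!sum_edge_mult -!big_split; apply: eq_bigr => v _; exact: G'E.
  by case: eqP => [<-|_]; lia.
- move=> l u v G'uv; have : (0 < G l u v) || (0 < edge_mult x' (z l) u v).
    by move: G'uv (G'E l u v) (leG l u v); lia.
  case/orP; first exact: suppG.
  rewrite /edge_mult addn_gt0 !lt0b => /orP[] /andP[/eqP<- /eqP<-]; rewrite -pxx'.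
    exact: suppG.
  by apply: suppG; rewrite symG.
(* The edges taken away are added to both sides to avoid subtraction; [sumE] counts them at [x] and
   at [x'] alike. The rest is arithmetic, by cases on whether [u] and [v] are [x], [x'] or
   neither. *)
move=> u v; set T' := (X in X = _).
have sumE x0 : \sum_k (edge_mult x0 (y1 k) u v + edge_mult x0 (y2 k) u v) +
    \sum_l edge_mult x0 (z l) u v = (x0 == u) * N v + (x0 == v) * N u.
  rewrite -!selN !mulnDr !big_distrr /= addnACA -!big_split /=.
  congr (_ + _); apply: eq_bigr => k _; rewrite /edge_mult ?mulnDr -!mulnb; lia.
have : T' + ((x == u) * N v + (x == v) * N u) =
       (part u != part v) * (mu * wt u * wt v) + ((x' == u) * N v + (x' == v) * N u).
  rewrite -!sumE -tot /T' addnACA [RHS]addnACA -!big_split /=; congr (_ + _).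
    rewrite (bigID (fun k => S k (part x))) [X in _ = X + _](bigID (fun k => S k (part x))) /=.
    rewrite (big_sub (fun k => S k (part x)) (fun k => walk_mult (W' k) u v)).
    rewrite (big_sub (fun k => S k (part x)) (fun k => walk_mult (W k) u v)).
    rewrite addnAC [RHS]addnAC -!big_split /=; congr (_ + _).
      by apply: eq_bigr => k _; rewrite /W' valK (wP k).2.
    by apply: eq_bigr => k nSk; rewrite /W' insubN.
  by apply: eq_bigr => l _; exact: G'E.
clearbody T'; rewrite /N.
case: (eqVneq x u) => [eu|xu]; [subst u|case: (eqVneq x' u) => [eu|x'u]; [subst u|]];
  (case: (eqVneq x v) => [ev|xv]; [subst v|case: (eqVneq x' v) => [ev|x'v]; [subst v|]]);
  rewrite -?pxx' ?eqxx ?[x' == x]eq_sym ?(negPf nxx') ?wx' ?[part u == _]eq_sym /=;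
  rewrite ?subn0 ?addn0 ?muln0 ?mul0n ?mul1n ?addn0 //.
all: case: (_ != _); rewrite ?mul1n ?mul0n ?addn0; case: (wt x) wx => // q _; nia.
Qed.

(** Induction on the number of vertices of weight 0. The average weight in each part is 1, so a
    vertex of weight 0 has a vertex of weight at least 2 in its part to split, and without zeros all
    weights are 1. *)
Lemma amalgam_all_one wt W G :
  amalgam wt W G ->
  (forall x, \sum_(y | part y == part x) wt y = #|[pred y | part y == part x]|) ->
  exists W' G', amalgam (fun=> 1) W' G'.
Proof.
have [N] := ubnP #|[pred z | wt z == 0]|; elim: N wt W G => // N IH wt W G.
rewrite ltnS => leN amG fiber.
have [/existsP[x' /eqP wx']|] := boolP [exists x', wt x' == 0]; last first.
  rewrite negb_exists => /forallP wt_gt0; exists W, G.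
  have wt1 x : wt x = 1.
    apply/eqP; rewrite eqn_leq lt0n wt_gt0 andbT leqNgt; apply/negP => wx.
    have := fiber x; rewrite -sum1_card; apply/eqP; rewrite gtn_eqF //.
    rewrite (eq_bigl (fun y => part y == part x)) // (bigD1 x) //=.
    rewrite [X in _ < X](bigD1 x) //= -addSn leq_add //.
    by apply: leq_sum => y _; rewrite lt0n.
  case: amG => cntW symG degG suppG tot; split=> // *.
  - by rewrite cntW wt1.
  - by rewrite degG wt1.
  - by rewrite tot !wt1.
have [x pxx' wx] : exists2 x, part x = part x' & 1 < wt x.
  have [/existsP[x /andP[/eqP]]|] :=
    boolP [exists x, (part x == part x') && (1 < wt x)]; first by exists x.
  rewrite negb_exists => /forallP le1.
  have := fiber x'; rewrite -sum1_card => /eqP; rewrite ltn_eqF //.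
  rewrite [X in _ < X](eq_bigl (fun y => part y == part x')) // (bigD1 x') //= wx'.
  rewrite [X in _ < X](bigD1 x') //= add0n add1n ltnS.
  by apply: leq_sum => y /andP[py _]; have := le1 y; rewrite py /= -leqNgt.
have nxx' : x != x' by apply: contraTneq wx => ->; rewrite wx'.
have [W' [G' amG']] := split_vertex amG pxx' wx wx'.
apply: IH amG' _ => [|y].
  apply: leq_trans leN; apply: proper_card; apply/properP; split.
    apply/subsetP => z; rewrite !inE => /eqP h; apply/eqP.
    by move: h; case: (eqVneq x z) => [<-|_] /=; lia.
  by exists x'; rewrite !inE ?wx' // eqxx addn1.
have sum1P t (P : pred V) : \sum_(z | P z) (t == z) = P t.
  rewrite big_mkcond (bigD1 t) //= eqxx big1 ?addn0; first by case: (P t).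
  by move=> z; rewrite eq_sym => /negPf->; case: (P z).
rewrite -fiber; apply/eqP.
rewrite -(eqn_add2r (\sum_(z | part z == part y) (x == z))) -big_split /=.
have -> : \sum_(z | part z == part y) (x == z) = \sum_(z | part z == part y) (x' == z).
  by rewrite !sum1P pxx'.
rewrite -big_split /=; apply/eqP/eq_bigr => z _.
by case: eqP => [<-|_]; lia.
Qed.

End Splitting.

(** * From complete to complete multipartite multigraphs *)

(** The closing vertex [y0] is kept free for the induction; at [y0 = a] the right side is
    [cycle_mult (a :: s)]. *)
Lemma path_next_mult (V : eqType) (y0 a : V) s u v : uniq (a :: s) ->
  path_mult a (rcons s y0) u v =
  ((u \in a :: s) && (next_at u y0 a s == v)) +
  ((v \in a :: s) && (next_at v y0 a s == u)).
Proof.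
elim: s a => [|b s IH] a /=.
  rewrite !inE /edge_mult addn0 => _.
  by case: (eqVneq u a) => [->|_]; case: (eqVneq v a) => [->|_]; rewrite ?eqxx.
case/andP=> /negPf nab ub; rewrite IH // ![_ \in [:: a, b & s]]in_cons /edge_mult.
rewrite ![a == _]eq_sym.
by case: (eqVneq u a) => [->|_]; case: (eqVneq v a) => [->|_];
   rewrite ?nab /= ?eqxx ?andbF ?addn0 ?add0n //; lia.
Qed.

Lemma walk_cycle_mult (V : finType) (c : seq V) : uniq c ->
  walk_mult c =2 cycle_mult c.
Proof. by case: c => // a s ua u v; rewrite /walk_mult path_next_mult. Qed.

Lemma path_mult_map (V V' : eqType) (f : V -> V') a s u v : injective f ->
  path_mult (f a) (map f s) (f u) (f v) = path_mult a s u v.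
Proof. by move=> injf; elim: s a => //= b s IH a; rewrite IH /edge_mult !inj_eq. Qed.

Lemma walk_mult_map (V V' : eqType) (f : V -> V') s u v : injective f ->
  walk_mult (map f s) (f u) (f v) = walk_mult s u v.
Proof. by case: s => //= a s injf; rewrite -map_rcons path_mult_map. Qed.

(** Row sum 1 singles out one neighbour of each vertex, and symmetry makes the neighbour map its own
    inverse. *)
Lemma one_regularP (V : finType) (G : V -> V -> nat) :
  (forall u v, G u v = G v u) -> (forall u, \sum_v G u v = 1) ->
  exists2 g : V -> V, involutive g & forall u v, G u v = (g u == v).
Proof.
move=> symG degG; have /fin_all_exists[g gP] u : exists v, G u v = 1.
  have /eqP/sum_nat_eq1[v [_ Guv _]] := degG u.
  by exists v.
have gE u v : G u v = (g u == v).
  have := degG u; rewrite (bigD1 (g u)) //= gP => /eqP.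
  rewrite -{2}[1]addn0 eqn_add2l sum_nat_eq0 => /forall_inP h.
  by case: (eqVneq (g u) v) => [<- //|ne]; apply/eqP/h; rewrite // eq_sym.
by exists g => // u; apply/eqP; have := gE (g u) u; rewrite symG gP; case: eqP.
Qed.

Lemma uniq_flatten (V : eqType) (ss : seq (seq V)) s :
  uniq (flatten ss) -> s \in ss -> uniq s.
Proof.
elim: ss => //= t ss IH; rewrite cat_uniq inE => /and3P[ut _ uss].
by case/orP=> [/eqP->|/(IH uss)].
Qed.

Lemma walk_mult_nseq (V : eqType) m (w : seq V) u v :
  walk_mult (flatten (nseq m w)) u v = m * walk_mult w u v.
Proof.
case: w => [|a s]; first by rewrite muln0; elim: m.
have -> : flatten (nseq m (a :: s)) = excursions a (nseq m s).
  by rewrite /excursions map_nseq.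
by rewrite walk_mult_excursions big_nseq iter_addn_0 mulnC.
Qed.

Lemma sum_fiber (I J : finType) (i : I) (F : I * J -> nat) :
  \sum_(y | y.1 == i) F y = \sum_j F (i, j).
Proof.
rewrite -(big_pred1_eq addn i (fun i => \sum_j F (i, j))) pair_big /=.
by apply: eq_big => [[a b]|[a b] _] //=; rewrite andbT.
Qed.

Section BlowUp.
Variables (mu n m : nat) (TT : seq (seq nat)).
Hypotheses (m_gt0 : 0 < m)
  (facT : has_2factorization (complete_mgraph (mu * m) n) TT).
Let V := ('I_n * 'I_m)%type.

(** The amalgam starts with the whole weight [m] of each part on one vertex and is split until all
    weights are 1. The remaining 1-factor [g l] then lies over the base 1-factor [sigma l]. *)
Lemma blow_up : exists r,
  [/\ regular r (complete_mgraph (mu * m) n), size TT = r./2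
    & exists (F : 'I_(size TT) -> mgraph V) (sigma : 'I_(odd r) -> 'I_n -> 'I_n)
             (g : 'I_(odd r) -> V -> V),
      [/\ forall j, has_type (F j) (scale_type m (nth [::] TT j)),
          forall u v, \sum_j mult (F j) u v + \sum_l (g l u == v) = 
                      mult (complete_multipartite mu n m) u v,
          forall l, involutive (g l) /\ involutive (sigma l)
        & forall l x, (g l x).1 = sigma l x.1 /\ sigma l x.1 != x.1]].
Proof.
case: facT => r [regr szT [F0 [I0 [_ facI sumE typF]]]].
exists r; split=> //.
have /fin_all_exists[cs csP] j := typF j.
(* All cycles of all 2-factors are split simultaneously; the first component of an index remembers
   the 2-factor. *)
pose K := {j : 'I_(size TT) & 'I_(size (cs j))}.
pose tg (j : 'I_(size TT)) (i : 'I_(size (cs j))) : K := existT _ j i.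
pose c (k : K) := nth [::] (cs (tag k)) (tagged k).
pose o : 'I_m := Ordinal m_gt0.
pose lift0 (u : 'I_n) : V := (u, o).
pose W0 k := flatten (nseq m (map lift0 (c k))).
pose G0 l (u v : V) := if (u.2 == o) && (v.2 == o) then m * mult (I0 l) u.1 v.1 else 0.
pose S (k : K) (u : 'I_n) := u \in c k.
pose R l u v := 0 < mult (I0 l) u v.
pose wt (u : V) := if u.2 == o then m else 0.
have c_mem (k : K) : c k \in cs (tag k) by rewrite mem_nth.
have c_uniq k : uniq (c k).
  have [_ p _ _] := csP (tag k); have := enum_uniq 'I_n; rewrite -(perm_uniq p).
  by move/uniq_flatten; apply.
have W0E k u v : walk_mult (W0 k) u v =
    if (u.2 == o) && (v.2 == o) then m * cycle_mult (c k) u.1 v.1 else 0.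
  have notin w : w.2 != o -> w \notin map lift0 (c k).
    by apply: contraNN => /mapP[a _ ->].
  rewrite /W0 walk_mult_nseq; case: (eqVneq u.2 o) => [eu|/notin nu] /=; last first.
    by rewrite walk_mult_notin // muln0.
  case: (eqVneq v.2 o) => [ev|/notin nv] /=; last first.
    by rewrite walk_mult_sym walk_mult_notin // muln0.
  have [-> ->] : u = lift0 u.1 /\ v = lift0 v.1.
    by rewrite /lift0 -{1}eu -ev -!surjective_pairing.
  by rewrite walk_mult_map ?walk_cycle_mult // => a b [].
have am0 : amalgam fst S R mu wt W0 G0.
  split.
  - move=> k [u a] /=; rewrite /W0 /wt /S /=.
    rewrite count_flatten map_nseq sumn_nseq count_map mulnC.
    case: eqP => [->|ao] /=; last first.
      by rewrite (eq_count (a2 := pred0)) ?count_pred0 ?muln0 // => b; apply/eqP => -[_ /esym].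
    rewrite (eq_count (a2 := pred1 u)) ?count_uniq_mem // 1?mulnC // => b.
    by rewrite /= /lift0 xpair_eqE eqxx andbT.
  - by move=> l u v; rewrite /G0 andbC mult_sym.
  - move=> l [u a]; rewrite /G0 /wt /=; case: eqP => _; last by rewrite big1.
    rewrite -(pair_big xpredT xpredT
                (fun v b => if b == o then m * mult (I0 l) u v else 0)) /=.
    rewrite (eq_bigr (fun v => m * mult (I0 l) u v)) => [|v _].
      by rewrite -big_distrr /= -/(degree (I0 l) u) (facI l).2 muln1.
    by rewrite -big_mkcond big_pred1_eq.
  - move=> l u v; rewrite /G0 /R; case: ifP => // _; rewrite muln_gt0.
    by case/andP.
  - move=> u v; rewrite (eq_bigr _ (fun k _ => W0E k u v)) /G0 /wt.
    case: (u.2 == o); last by rewrite !big1 ?muln0 ?mul0n.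
    case: (v.2 == o); last by rewrite !big1 ?muln0.
    rewrite -!big_distrr -mulnDr /=.
    have -> : \sum_k cycle_mult (c k) u.1 v.1 = \sum_j mult (F0 j) u.1 v.1.
      have sdep := sig_big_dep (fun _ => true) (fun j (_ : 'I_(size (cs j))) => true)
        (fun j i => cycle_mult (nth [::] (cs j) i) u.1 v.1).
      rewrite -sdep; apply: eq_bigr => j _; have [_ _ -> _] := csP j.
      by rewrite (big_nth [::]) big_mkord.
    by rewrite -sumE /=; case: (_ != _); lia.
have [|W [G [cntW symG degG suppG tot]]] := amalgam_all_one am0.
  move=> x; rewrite -sum1_card sum_fiber (sum_fiber _ (fun=> 1)) /wt /=.
  by rewrite -big_mkcond big_pred1_eq sum_nat_const card_ord muln1.
have /fin_all_exists2[sigma sigK sigE] l :=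
   one_regularP (mult_sym (I0 l)) (fun u => (facI l).2 u).
have /fin_all_exists2[g gK gE] l := one_regularP (symG l) (degG l).
(* The balanced total vanishes on the diagonal, hence so does each of its summands. *)
have Firr j v : \sum_(i : 'I_(size (cs j))) walk_mult (W (tg _ i)) v v = 0.
  have := tot v v; rewrite eqxx mul0n => /eqP; rewrite addn_eq0 => /andP[].
  by rewrite sum_nat_eq0 => /forall_inP W_0 _; rewrite big1 // => i _; apply/eqP/W_0.
have Fsym j u v : \sum_(i : 'I_(size (cs j))) walk_mult (W (tg _ i)) u v =
    \sum_(i : 'I_(size (cs j))) walk_mult (W (tg _ i)) v u.
  by apply: eq_bigr => i _; rewrite walk_mult_sym.
pose F j := MGraph (Fsym j) (Firr j).
exists F, sigma, g; split.
- move=> j; exists [seq W (tg _ i) | i <- enum 'I_(size (cs j))].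
  (* With unit weights [W k] visits every vertex of every part over [c k] exactly once: it is a
     cycle of length [m * size (c k)]. *)
  have Wmem k : W k =i [pred x | x.1 \in c k].
    by move=> x; rewrite -has_pred1 has_count cntW muln1 lt0b.
  have Wuniq k : uniq (W k).
    by apply: count_mem_uniq => x; rewrite cntW muln1 Wmem.
  have szW k : size (W k) = m * size (c k).
    rewrite -(card_uniqP (Wuniq k)) (eq_card (Wmem k)) -sum1_card.
    rewrite (eq_bigl (fun x => (x.1 \in c k) && true)) => [|x]; last by rewrite andbT.
    rewrite -(pair_big (fun a => a \in c k) xpredT (fun _ _ => 1)) /=.
    by rewrite sum_nat_const (card_uniqP (c_uniq k)) sum_nat_const card_ord muln1 mulnC.
  have [cs2 csE _ csT] := csP j; split.
  + apply/allP => w /mapP[i _ ->]; rewrite szW.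
    have /(allP cs2) c2 := c_mem (tg _ i).
    by apply: leq_trans c2 _; rewrite leq_pmull.
  + apply/allP => x _ /=; apply/eqP; rewrite [RHS]count_uniq_mem ?enum_uniq // mem_enum.
    rewrite count_flatten -map_comp sumnE big_map big_enum /=.
    transitivity (count_mem x.1 (flatten (cs j))); last first.
      by rewrite (permP csE) count_uniq_mem ?enum_uniq // mem_enum.
    rewrite count_flatten sumnE big_map (big_nth [::]) big_mkord.
    by apply: eq_bigr => i _; rewrite cntW muln1 -count_uniq_mem.
  + move=> u v; rewrite big_map big_enum /=; apply: eq_bigr => i _.
    exact: walk_cycle_mult.
  + apply: perm_trans (perm_map (muln m) csT).
    rewrite -!map_comp (eq_map (g := fun i => m * size (c (tg _ i)))).
      rewrite (map_comp (fun w => m * size w) (fun i : 'I_(size (cs j)) => nth [::] (cs j) i)).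
      rewrite (map_comp (nth [::] (cs j)) (@nat_of_ord _)) -enumT val_enum_ord.
      by rewrite -/(mkseq (nth [::] (cs j)) (size (cs j))) mkseq_nth.
    by move=> i; rewrite /= szW.
- move=> u v; rewrite /= -(eq_bigr _ (fun l _ => gE l u v)).
  have sdep := sig_big_dep (fun _ => true) (fun j (_ : 'I_(size (cs j))) => true)
    (fun j i => walk_mult (W (tg _ i)) u v).
  rewrite sdep (eq_bigr (fun k => walk_mult (W k) u v)) => [|[j i] _ //].
  by rewrite tot !muln1; case: (_ != _); rewrite ?mul1n.
- by move=> l; split.
- move=> l x; split.
    have := gE l x (g l x); rewrite eqxx => Gx.
    have := suppG l x (g l x); rewrite Gx /R sigE => /(_ isT).
    by rewrite lt0b => /eqP.
  by have := sigE l x.1 x.1; rewrite mult_irr; case: eqP.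
Qed.

End BlowUp.

(** * Decompositions into 2-factors of given types *)

Lemma bijP (T T' : Type) (f : T -> T') : bijective f ->
  exists g, cancel f g /\ cancel g f.
Proof. by case=> g; exists g. Qed.

Section Pull.
Variables (V V' : finType) (f : V -> V') (H : mgraph V').

Definition pull : mgraph V :=
  MGraph (fun u v => mult_sym H (f u) (f v)) (fun v => mult_irr H (f v)).

Lemma has_type_pull T : bijective f -> has_type H T -> has_type pull T.
Proof.
move=> /bijP[g [fK gK]] [cs [cs2 csE csM csT]]; have injg := can_inj gK.
exists [seq map g c | c <- cs]; split.
- by rewrite all_map (eq_all (a2 := fun c => 1 < size c)) // => c /=; rewrite size_map.
- rewrite -map_flatten (perm_trans (perm_map g csE)) // uniq_perm ?enum_uniq //.
    by rewrite map_inj_uniq ?enum_uniq.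
  by move=> u; rewrite mem_enum; apply/mapP; exists (f u); rewrite ?mem_enum ?fK.
- move=> u v; rewrite /= csM big_map; apply: eq_big_seq => c cc.
  have uc : uniq c by apply: uniq_flatten cc; rewrite (perm_uniq csE) enum_uniq.
  by rewrite -{2}[u]fK -{2}[v]fK -!walk_cycle_mult ?map_inj_uniq // walk_mult_map.
- by rewrite -map_comp (eq_map (g := size)) // => c /=; rewrite size_map.
Qed.

End Pull.

(** Each vertex lies on exactly one of the cycles, where its successor and its predecessor
    contribute 1 each. *)
Lemma has_type_regular (V : finType) (H : mgraph V) T : has_type H T -> regular 2 H.
Proof.
case=> cs [_ csE csM _] u; rewrite /degree (eq_bigr _ (fun v _ => csM u v)).
have uniqcs c : c \in cs -> uniq c.
  by apply: uniq_flatten; rewrite (perm_uniq csE) enum_uniq.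
rewrite exchange_big /= (eq_big_seq (fun c => 2 * count_mem u c)) => [|c cc].
  rewrite -big_distrr /= -[RHS]muln1; congr (2 * _).
  have := permP csE (pred1 u); rewrite count_flatten sumnE big_map => ->.
  by rewrite count_uniq_mem ?enum_uniq // mem_enum.
have uc := uniqcs c cc; rewrite count_uniq_mem // /cycle_mult big_split /= mul2n -addnn.
congr (_ + _).
  by case: (u \in c); rewrite ?sum_eql // big1.
case: (boolP (u \in c)) => uc'.
  rewrite -[RHS](sum_eqr (prev c u)); apply: eq_bigr => v _; congr nat_of_bool.
  apply/andP/eqP => [[_ /eqP<-]|->]; first by rewrite prev_next.
  by rewrite mem_prev next_prev.
rewrite big1 // => v _; case: eqP => [e|_]; last by rewrite andbF.
by rewrite -(mem_next c v) e (negPf uc').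
Qed.

Section Decomposes.
Variable V : finType.
Implicit Types (TT : seq (seq nat)) (M : V -> V -> nat).

(** Recursion on the list of types avoids families indexed by ['I_(size TT)], which makes
    concatenation and copying easy; [decomposesP] translates back. *)
Fixpoint decomposes TT M : Prop :=
  if TT is T :: TT' then
    exists H M', [/\ has_type H T, decomposes TT' M' &
                     forall u v, M u v = mult H u v + M' u v]
  else forall u v, M u v = 0.

Lemma eq_decomposes TT M M' : M =2 M' -> decomposes TT M -> decomposes TT M'.
Proof.
case: TT => [|T TT] eM /=; first by move=> M0 u v; rewrite -eM.
by case=> H [N [tH dN MN]]; exists H, N; split=> // u v; rewrite -eM.
Qed.

Lemma decomposes_cat TT1 TT2 M1 M2 :
  decomposes TT1 M1 -> decomposes TT2 M2 ->
  decomposes (TT1 ++ TT2) (fun u v => M1 u v + M2 u v).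
Proof.
elim: TT1 M1 => [|T TT1 IH] M1 /=.
  by move=> M10; apply: eq_decomposes => u v; rewrite M10.
move=> [H [N [tH dN MN]]] d2; exists H, (fun u v => N u v + M2 u v).
by split=> // [|u v]; [exact: IH | rewrite MN addnA].
Qed.

Lemma decomposesP TT M : decomposes TT M <->
  exists2 F : 'I_(size TT) -> mgraph V,
    (forall j, has_type (F j) (nth [::] TT j)) &
    (forall u v, M u v = \sum_j mult (F j) u v).
Proof.
elim: TT M => [|T TT IH] M /=.
  split=> [M0|[F _ FM] u v]; last by rewrite FM big_ord0.
  have F (j : 'I_0) : mgraph V by case: j.
  by exists F => [[]|u v] //; rewrite big_ord0.
split=> [[H [N [tH /IH[F tF FN] MN]]]|[F tF FM]].
  exists (fun j => if unlift ord0 j is Some k then F k else H) => [j|u v].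
    by case: unliftP => [k ->|->] //=; exact: tF.
  rewrite MN FN big_ord_recl unlift_none; congr (_ + _).
  by apply: eq_bigr => j _; rewrite liftK.
exists (F ord0), (fun u v => \sum_j mult (F (lift ord0 j)) u v); split.
- exact: (tF ord0).
- by apply/IH; exists (fun j => F (lift ord0 j)) => // j; exact: (tF (lift ord0 j)).
- by move=> u v; rewrite FM big_ord_recl.
Qed.

End Decomposes.

Lemma decomposes_pull (V V' : finType) (f : V -> V') TT (M : V' -> V' -> nat) :
  bijective f -> decomposes TT M -> decomposes TT (fun u v => M (f u) (f v)).
Proof.
move=> bf; elim: TT M => [|T TT IH] M /=; first by move=> M0 u v.
case=> H [N [tH dN MN]]; exists (pull f H), (fun u v => N (f u) (f v)).
by split=> [||u v]; [exact: has_type_pull | exact: IH | rewrite MN].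
Qed.

(** Relabelling preserves types, so every copy [c] may use its own relabelling [chi c]. *)
Lemma decomposes_copies (V : finType) (chi : nat -> V -> V) x TT (M : V -> V -> nat) :
  (forall c, bijective (chi c)) -> decomposes TT M ->
  decomposes (flatten [seq nseq x T | T <- TT])
    (fun u v => \sum_(c < x) M (chi c u) (chi c v)).
Proof.
move=> bchi; elim: TT M => [|T TT IH] M /=.
  by move=> M0 u v; rewrite big1.
case=> H [N [tH dN MN]].
have dH : decomposes (nseq x T) (fun u v => \sum_(c < x) mult H (chi c u) (chi c v)).
  elim: x {IH} => [|x IHx] /=; first by move=> u v; rewrite big_ord0.
  exists (pull (chi x) H), (fun u v => \sum_(c < x) mult H (chi c u) (chi c v)).
  by split=> [||u v] //; [exact: has_type_pull | rewrite big_ord_recr addnC].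
apply: eq_decomposes (decomposes_cat dH (IH _ dN)) => u v.
by rewrite -big_split; apply: eq_bigr => c _; rewrite MN.
Qed.

(** * Bipartite 2-factors as unions of two 1-factors *)

Section Standard.
Variables h m : nat.

(* The vertex [(i, a, b)] lies in the [b]-th part of the [i]-th of [h] pairs of
   parts; [std] is the 1-factor joining [(i, a, false)] to [(i, a, true)]. *)
Local Notation slot := ('I_h * 'I_m)%type.
Local Notation Q := (slot * bool)%type.

Definition part_of (q : Q) := (q.1.1, q.2).

Definition std (u v : Q) : bool := (u.1 == v.1) && (u.2 != v.2).

Lemma std_sym u v : std u v = std v u :> nat.
Proof. by rewrite /std eq_sym [u.2 == _]eq_sym. Qed.

Lemma std_irr u : std u u = 0 :> nat.
Proof. by rewrite /std !eqxx. Qed.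

Definition std_factor : mgraph Q := MGraph std_sym std_irr.

Lemma stdE u v : std u v = ((u.1, ~~ u.2) == v).
Proof. by case: u v => [x b] [y c]; rewrite /std xpair_eqE /=; case: b c => [] []. Qed.

Definition pairs_multipartite mu : mgraph Q :=
  @MGraph Q (fun u v => if part_of u != part_of v then mu else 0)
    (fun u v => complete_mult_sym mu (part_of u) (part_of v))
    (fun v => complete_mult_irr mu (part_of v)).

Lemma standard_leave n (sigma : 'I_n -> 'I_n) (g : 'I_n * 'I_m -> 'I_n * 'I_m) :
  h = n./2 -> involutive g -> involutive sigma ->
  (forall x, (g x).1 = sigma x.1) -> (forall i, sigma i != i) ->
  exists phi : Q -> 'I_n * 'I_m,
    [/\ bijective phi,
        forall p q, ((phi p).1 == (phi q).1) = (part_of p == part_of q)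
      & forall p q, (g (phi p) == phi q) = std p q].
Proof.
(* [A] selects one part from each pair swapped by [sigma]; [sigma] exchanges it with its complement,
   so it has [n./2] elements. *)
move=> hn gK sK gE sne; pose A := [set u : 'I_n | u < sigma u].
have Acase u : (sigma u \in A) = (u \notin A).
  by rewrite !inE sK; have := sne u; rewrite -val_eqE /=; lia.
have cardA : #|A| + #|A| = n.
  rewrite -[RHS]card_ord -(cardsC A); congr (_ + _).
  rewrite -(on_card_preimset (f := sigma)); last by exists sigma => u _; rewrite sK.
  by apply: eq_card => u; rewrite in_setC -Acase !inE.
have hA : h = #|A| by move: cardA; rewrite hn; lia.
pose e (i : 'I_h) : 'I_n := enum_val (cast_ord hA i).
have eA i : e i \in A by exact: enum_valP.
have inje : injective e by move=> i j /enum_val_inj /cast_ord_inj.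
(* The [false] side is mapped to the selected parts and the [true] side to the partners under [g],
   so [g] becomes [std]. *)
pose phi (q : Q) := if q.2 then g (e q.1.1, q.1.2) else (e q.1.1, q.1.2).
have phi1 q : (phi q).1 = if q.2 then sigma (e q.1.1) else e q.1.1.
  by rewrite /phi; case: q.2; rewrite ?gE.
have partE p q : ((phi p).1 == (phi q).1) = (part_of p == part_of q).
  rewrite !phi1 /part_of xpair_eqE.
  have neq i j : (sigma (e i) == e j) = false.
    by apply/eqP => eij; have := Acase (e i); rewrite eij !eA.
  case: p q => [[i a] []] [[j b] []] /=; rewrite ?andbT ?andbF ?neq //.
  - by rewrite (inj_eq (can_inj sK)) (inj_eq inje).
  - by rewrite eq_sym neq.
  - by rewrite (inj_eq inje).
have inj_phi : injective phi.
  move=> p q epq; have := partE p q; rewrite epq eqxx => /esym/eqP.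
  move: epq; case: p q => [[i a] b] [[j c] d] + [eij ebd]; rewrite /= in eij ebd *.
  subst j d; rewrite /phi /=.
  by case: b => [/(can_inj gK)|] [->].
exists phi; split=> // [|p q].
  by apply: inj_card_bij => //; rewrite !card_prod !card_ord card_bool; lia.
rewrite stdE -(inj_eq inj_phi); congr (_ == _).
by rewrite /phi /=; case: p.2; rewrite //= gK.
Qed.

Lemma uniq_flatten_eq (T : eqType) (ss : seq (seq T)) s t x :
  uniq (flatten ss) -> s \in ss -> t \in ss -> x \in s -> x \in t -> s = t.
Proof.
elim: ss => //= r ss IH; rewrite cat_uniq !inE => /and3P[ur /hasPn dis uss].
have inF w : w \in ss -> x \in w -> x \in flatten ss.
  by move=> wss xw; apply/flattenP; exists w.
case/orP=> [/eqP->|ss_s]; case/orP=> [/eqP->|ss_t] // xs xt.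
- by have := dis x (inF _ ss_t xt); rewrite xs.
- by have := dis x (inF _ ss_s xs); rewrite xt.
- exact: IH.
Qed.

(** The successor maps of disjoint cycles covering [T] glue together, and [prev] inverts them cycle
    by cycle. *)
Lemma next_permutation (T : finType) (cs : seq (seq T)) :
  perm_eq (flatten cs) (enum T) ->
  exists2 tau : T -> T, injective tau & forall c x, c \in cs -> x \in c -> tau x = next c x.
Proof.
move=> csE; have ucs : uniq (flatten cs) by rewrite (perm_uniq csE) enum_uniq.
have /fin_all_exists[cyc cycP] x : exists c, (c \in cs) && (x \in c).
  have : x \in flatten cs by rewrite (perm_mem csE) mem_enum.
  by case/flattenP => c ccs xc; exists c; rewrite ccs.
have cycE c x : c \in cs -> x \in c -> cyc x = c.
  move=> ccs xc; have /andP[cx xcx] := cycP x.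
  exact: uniq_flatten_eq ucs cx ccs xcx xc.
exists (fun x => next (cyc x) x) => [x y exy|c x ccs xc]; last by rewrite (cycE c).
have /andP[cx xcx] := cycP x; have /andP[cy ycy] := cycP y.
have ec : cyc x = cyc y.
  apply: (uniq_flatten_eq (x := next (cyc x) x) ucs cx cy); first by rewrite mem_next.
  by rewrite exy mem_next.
by rewrite -(prev_next (uniq_flatten ucs cx) x) exy ec prev_next // (uniq_flatten ucs cy).
Qed.

(** As a cycle, this alternates between edges of [std] and edges from [(x, true)] to the [false]
    copy of the successor of [x]. *)
Definition double_up (c : seq slot) : seq Q :=
  flatten [seq [:: (x, false); (x, true)] | x <- c].

Lemma count_double_up x b c : count_mem (x, b) (double_up c) = count_mem x c.
Proof.
elim: c => //= y c IH; rewrite !xpair_eqE IH addnA; congr (_ + _).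
by case: (y == x); case: (b).
Qed.

Lemma size_double_up c : size (double_up c) = 2 * size c.
Proof. by elim: c => //= x c ->; lia. Qed.

Lemma walk_mult_double_up c u v : uniq c ->
  walk_mult (double_up c) u v =
  \sum_(x <- c) (edge_mult (x, false) (x, true) u v +
                 edge_mult (x, true) (next c x, false) u v).
Proof.
case: c => [|x s]; first by rewrite big_nil.
rewrite /walk_mult /= -/(double_up s).
suff gen y0 : uniq (x :: s) ->
    edge_mult (x, false) (x, true) u v +
      path_mult (x, true) (rcons (double_up s) (y0, false)) u v =
    \sum_(z <- x :: s) (edge_mult (z, false) (z, true) u v +
                 edge_mult (z, true) (next_at z y0 x s, false) u v) by exact: gen.
elim: s x => [|y s IH] x; first by rewrite big_seq1 /= eqxx addn0.
case/andP=> xys uys; rewrite big_cons /= eqxx -addnA; congr (_ + (_ + _)).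
rewrite IH //; apply: eq_big_seq => z zs.
by case: eqP => // ez; rewrite -ez zs in xys.
Qed.

Lemma sum_eq_and (T : finType) (t : T) (p : pred T) :
  \sum_x ((x == t) && p x) = p t.
Proof. by rewrite (bigD1 t) //= eqxx big1 ?addn0 // => x /negPf->. Qed.

(** The halved entries of [S] fall into groups of sum [m], so the [m] slots of each pair of parts
    can be cut into cyclic lists of these lengths. Doubling the lists gives cycles of type [S] whose
    edges alternate between [std] and a relabelled [std]. *)
Lemma refinement_std S :
  bipartite_type S -> refinement S (nseq h (2 * m)) ->
  exists chi : Q -> Q, [/\ bijective chi, forall p, part_of (chi p) = part_of p
    & exists2 H : mgraph Q, has_type H S &
        forall u v, mult H u v = std u v + std (chi u) (chi v)].
Proof.
move=> /allP evenS [/allP posS [P sumP]].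
pose half (j : 'I_(size S)) := (nth 0 S j)./2.
have halfK (j : 'I_(size S)) : 2 * half j = nth 0 S j.
  have /evenS := mem_nth 0 (ltn_ord j); rewrite /half; lia.
pose J (i : 'I_h) := [seq j <- enum 'I_(size S) | P j == i :> nat].
pose blk (i : 'I_h) : seq slot := [seq (i, a) | a <- enum 'I_m].
have sz_blk i : size (blk i) = m by rewrite size_map size_enum_ord.
have sum_half i : sumn (map half (J i)) = m.
  apply/eqP; rewrite -(eqn_pmul2l (m := 2)) //; apply/eqP.
  have := sumP (cast_ord (esym (size_nseq h (2 * m))) i).
  rewrite nth_nseq /= ltn_ord => <-; rewrite sumnE big_map big_filter big_enum_cond big_distrr.
  by apply: eq_big => // j _; rewrite halfK.
pose css := flatten [seq reshape (map half (J i)) (blk i) | i <- enum 'I_h].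
have flat_css : flatten css = [seq (i, a) | i <- enum 'I_h, a <- enum 'I_m].
  rewrite /css; elim: (enum 'I_h) => //= i s IH.
  by rewrite flatten_cat IH reshapeKr // sz_blk sum_half.
have cssE : perm_eq (flatten css) (enum {: slot}).
  rewrite flat_css uniq_perm ?enum_uniq //.
    by rewrite allpairs_uniq ?enum_uniq // => -[a b] [c d].
  by move=> [a b]; rewrite mem_enum allpairs_f ?mem_enum.
have css_shape : perm_eq [seq 2 * size c | c <- css] S.
  have permJ : perm_eq (flatten [seq J i | i <- enum 'I_h]) (enum 'I_(size S)).
    apply/allP => j _ /=; apply/eqP; rewrite [RHS]count_uniq_mem ?enum_uniq // mem_enum.
    rewrite count_flatten -map_comp sumnE big_map big_enum /=.
    rewrite -[RHS](sum_eql (cast_ord (size_nseq h (2 * m)) (P j))).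
    apply: eq_big => // i _; rewrite count_uniq_mem; last by rewrite filter_uniq // enum_uniq.
    by rewrite mem_filter mem_enum andbT.
  have -> : [seq 2 * size c | c <- css] =
            [seq nth 0 S j | j : 'I_(size S) <- flatten [seq J i | i <- enum 'I_h]].
    rewrite /css !map_flatten -!map_comp; congr flatten; apply: eq_map => i /=.
    rewrite (map_comp (muln 2) size) -/(shape _) reshapeKl ?sz_blk ?sum_half //.
    by rewrite -map_comp; apply: eq_map => j /=; rewrite halfK.
  rewrite (perm_trans (perm_map _ permJ)) //.
  rewrite (map_comp (nth 0 S) (@nat_of_ord _)) val_enum_ord.
  by rewrite -/(mkseq (nth 0 S) (size S)) mkseq_nth.
have [tau inj_tau tauE] := next_permutation cssE.
(* Every list stays within one pair of parts, hence [chi] below preserves the parts. *)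
have tau1 x : (tau x).1 = x.1.
  have : x \in flatten css by rewrite (perm_mem cssE) mem_enum.
  case/flattenP => c ccss xc; rewrite (tauE c) //.
  have /flatten_mapP[i _ ci] := ccss.
  have fst_i y : y \in c -> y.1 = i.
    move=> yc; have : y \in blk i.
      rewrite -(@reshapeKr _ (map half (J i)) (blk i)) ?sz_blk ?sum_half //.
      by apply/flattenP; exists c.
    by case/mapP => a _ ->.
  by rewrite !fst_i ?mem_next.
(* Shifting only the [true] side turns the edges from [(x, true)] to [(tau x, false)] into edges of
   [std]. *)
pose chi (q : Q) : Q := (if q.2 then tau q.1 else q.1, q.2).
have ucss c : c \in css -> uniq c.
  by apply: uniq_flatten; rewrite (perm_uniq cssE) enum_uniq.
pose cs := map double_up css.
have ucs c : c \in css -> uniq (double_up c).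
  move=> /ucss uc; apply: count_mem_uniq => -[x b].
  by rewrite -has_pred1 has_count count_double_up count_uniq_mem // lt0b.
have cs_mult u v : \sum_(c <- cs) cycle_mult c u v = std u v + std (chi u) (chi v).
  rewrite big_map.
  have -> : \sum_(c <- css) cycle_mult (double_up c) u v =
    \sum_(x : slot) (edge_mult (x, false) (x, true) u v +
                     edge_mult (x, true) (tau x, false) u v).
    rewrite -big_enum -(perm_big _ cssE) [RHS]big_flatten /=.
    apply: eq_big_seq => c cc; rewrite -walk_cycle_mult ?ucs // walk_mult_double_up ?ucss //.
    by apply: eq_big_seq => x xc; rewrite (tauE c).
  rewrite big_split /=; congr (_ + _).
    case: u v => [y b] [z c]; rewrite -[RHS](@sum_eq_and slot y (fun x => (x == z) && (b != c))).
    by apply: eq_bigr => x _; rewrite /edge_mult !xpair_eqE; case: b c => [] [] /=;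
      rewrite ?andbT ?andbF ?addn0 ?add0n // andbC.
  case: u v => [y b] [z c]; rewrite /std /=.
  case: b c => [] [] /=; rewrite ?andbF ?andbT.
  - by rewrite big1 // => x _; rewrite /edge_mult !xpair_eqE /= !andbF.
  - rewrite -[RHS](@sum_eq_and slot y (fun x => tau x == z)).
    by apply: eq_bigr => x _; rewrite /edge_mult !xpair_eqE /= !andbF !andbT addn0.
  - rewrite eq_sym -[RHS](@sum_eq_and slot z (fun x => tau x == y)).
    by apply: eq_bigr => x _; rewrite /edge_mult !xpair_eqE /= !andbF !andbT.
  - by rewrite big1 // => x _; rewrite /edge_mult !xpair_eqE /= !andbF.
have Hsym u v : \sum_(c <- cs) cycle_mult c u v = \sum_(c <- cs) cycle_mult c v u.
  by rewrite !cs_mult std_sym [in X in _ + X]std_sym.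
have Hirr v : \sum_(c <- cs) cycle_mult c v v = 0 by rewrite cs_mult !std_irr.
exists chi; split.
- apply: injF_bij => -[x b] [y c]; rewrite /chi /= => -[+ ebc].
  by rewrite ebc; case: c {ebc} => [/inj_tau|] ->.
- by move=> [x b]; rewrite /part_of /=; case: b; rewrite ?tau1.
exists (MGraph Hsym Hirr) => [|u v]; last by rewrite /= cs_mult.
exists cs; split=> //.
- apply/allP => w /mapP[c ccss ->]; rewrite size_double_up.
  suff : 0 < 2 * size c by case: (size c) => // k _; rewrite mulnS.
  by apply: posS; rewrite -(perm_mem css_shape); apply/mapP; exists c.
- apply/allP => -[x b] _ /=; apply/eqP; rewrite [RHS]count_uniq_mem ?enum_uniq // mem_enum.
  rewrite count_flatten -map_comp (eq_map (g := count_mem x)) => [|c]; last exact: count_double_up.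
  by rewrite -count_flatten (permP cssE) count_uniq_mem ?enum_uniq // mem_enum.
- by rewrite -map_comp (eq_map (g := fun c => 2 * size c)) // => c; exact: size_double_up.
Qed.

End Standard.

(** * Assembling the factorization *)

Lemma degree_complete mu n (u : 'I_n) : degree (complete_mgraph mu n) u = mu * n.-1.
Proof.
rewrite /degree (bigD1 u) //= eqxx add0n.
rewrite (eq_bigr (fun=> mu)) => [|v]; last by rewrite eq_sym => ->.
by rewrite sum_nat_const cardC1 card_ord mulnC.
Qed.

(** The boolean [b] tells whether the 1-factor [G] occurs, so both parities of the degree are
    treated at once. *)
Lemma has_2factorization_decomposes (V : finType) (K G : mgraph V) TT M (b : bool) :
  decomposes TT M -> regular 1 G ->
  (forall u v, M u v + b * mult G u v = mult K u v) -> has_2factorization K TT.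
Proof.
move=> /decomposesP[F tF FM] regG KE.
have odd_r : odd (size TT * 2 + b) = b by rewrite oddD muln2 odd_double /=; case: b {KE}.
exists (size TT * 2 + b); split.
- move=> u; rewrite /degree (eq_bigr _ (fun v _ => esym (KE u v))) big_split /=.
  rewrite -big_distrr /= -/(degree G u) regG muln1; congr (_ + _).
  rewrite (eq_bigr _ (fun v _ => FM u v)) exchange_big /=.
  rewrite (eq_bigr (fun=> 2)) => [|j _]; last exact: (has_type_regular (tF j) u).
  by rewrite sum_nat_const card_ord.
- by rewrite addnC muln2 half_bit_double.
rewrite odd_r; exists F, (fun=> G).
have sumG u v : \sum_(j < b) mult G u v = b * mult G u v.
  by rewrite sum_nat_const card_ord.
split=> [j|j|u v|//].
- split=> [u v|]; last exact: has_type_regular (tF j).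
  by rewrite -KE FM (bigD1 j) //= -addnA leq_addr.
- split=> // u v; rewrite -KE; case: b j {KE odd_r sumG} => [j|[]//].
  by rewrite mul1n leq_addl.
- by rewrite sumG -FM KE.
Qed.

Lemma sum_double_half b (F : nat -> nat) :
  \sum_(i < b./2.*2) F i + odd b * F b.-1 = \sum_(i < b) F i.
Proof.
rewrite -(big_mkord xpredT F) -[RHS](big_mkord xpredT F).
have := odd_double_half b; case: (odd b) => /= [|e]; last first.
  by rewrite addn0 -[in RHS]e.
by rewrite add1n mul1n => e; rewrite -[in RHS]e big_nat_recr // -[in F b.-1]e.
Qed.

Section Assembly.
Variables (n m : nat).
Hypotheses (n_gt0 : 0 < n) (n_even : ~~ odd n) (m_gt0 : 0 < m).
Let h := n./2.
Local Notation Q := ('I_h * 'I_m * bool)%type.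

(** A mere identification of the vertex sets carrying parts to parts; since [n] is even, reversal of
    ['I_n] has no fixed point and pairs up the parts. *)
Lemma rev_ord_leave : exists phi : Q -> 'I_n * 'I_m, bijective phi /\
  forall p q, ((phi p).1 == (phi q).1) = (part_of p == part_of q).
Proof.
have [||||phi [bij_phi partE _]] := @standard_leave h m n (@rev_ord n)
    (fun x => (rev_ord x.1, x.2)) erefl; last by exists phi.
- by case=> i a; rewrite /= rev_ordK.
- exact: rev_ordK.
- by [].
- move=> i; rewrite -val_eqE /=; apply: contraNneq n_even => e.
  by move: (ltn_ord i) e; lia.
Qed.

(** In odd degree the coordinates are adapted to the 1-factor left over, which becomes [std]; in
    even degree any identification of the parts will do. *)
Lemma factors_over_pairs mu TT :
  has_2factorization (complete_mgraph (mu * m) n) TT ->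
  exists2 B : Q -> Q -> nat, decomposes [seq scale_type m T | T <- TT] B &
    forall u v, B u v + odd (mu * m * n.-1) * std u v =
                mult (pairs_multipartite h m mu) u v.
Proof.
move=> facT; have [r [regr szT [F [sigma [g [tF]]]]]] := blow_up m_gt0 facT.
have -> : odd (mu * m * n.-1) = odd r.
  by rewrite -(regr (Ordinal n_gt0)) degree_complete.
have dF (phi : Q -> 'I_n * 'I_m) : bijective phi ->
    decomposes [seq scale_type m T | T <- TT]
      (fun u v => \sum_j mult (F j) (phi u) (phi v)).
  move=> bij_phi; apply: (decomposes_pull (M := fun u v => \sum_j mult (F j) u v)) => //.
  move: F tF; rewrite -(size_map (scale_type m) TT) => F tF.
  apply/decomposesP; exists F => // j.
  by rewrite (nth_map [::]) // -[X in _ < X](size_map (scale_type m)).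
move: (odd r) sigma g => b sigma g FE invg gE.
have multE (phi : Q -> 'I_n * 'I_m) u v :
    (forall p q, ((phi p).1 == (phi q).1) = (part_of p == part_of q)) ->
    mult (complete_multipartite mu n m) (phi u) (phi v) =
    mult (pairs_multipartite h m mu) u v by move=> /= ->.
case: b sigma g FE invg gE => sigma g FE invg gE.
  have [gK sK] := invg ord0.
  have [||phi [bij_phi partE stdE']] := @standard_leave h m n _ _ erefl gK sK.
  - by move=> x; case: (gE ord0 x).
  - by move=> i; have [] := gE ord0 (i, Ordinal m_gt0).
  exists (fun u v => \sum_j mult (F j) (phi u) (phi v)) => [|u v]; first exact: dF.
  by rewrite -(multE phi) // -FE big_ord1 stdE' mul1n.
have [phi [bij_phi partE]] := rev_ord_leave.
exists (fun u v => \sum_j mult (F j) (phi u) (phi v)) => [|u v]; first exact: dF.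
by rewrite -(multE phi) // -FE big_ord0.
Qed.

Definition part_preserving (chi : Q -> Q) :=
  bijective chi /\ forall p, part_of (chi p) = part_of p.

(** Each type consumes two consecutive copies of [std]: the even index carries the identity, the odd
    one the relabelling from [refinement_std]. *)
Lemma bipartite_factors (S : seq (seq nat)) :
  (forall T, T \in S -> bipartite_type T /\ refinement T (nseq h (2 * m))) ->
  exists2 chi : nat -> Q -> Q, forall b, part_preserving (chi b) &
    decomposes S (fun u v => \sum_(b < (size S).*2) std (chi b u) (chi b v)).
Proof.
elim: S => [|T S IH] TS.
  by exists (fun _ p => p) => [b|u v]; [split=> //; exists id | rewrite big_ord0].
have [chi0 chi0P dS] := IH (fun T' h' => TS T' (mem_behead (s := T :: S) h')).
have [Teven Tref] := TS T (mem_head _ _).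
have [chiT [bT pT [H tH HE]]] := refinement_std Teven Tref.
exists (fun b => match b with 0 => id | 1 => chiT | b.+2 => chi0 b end).
  by case=> [|[|b]] //; split=> //; exists id.
exists H, (fun u v => \sum_(b < (size S).*2) std (chi0 b u) (chi0 b v)); split=> // u v.
by rewrite HE /= doubleS !big_ord_recl addnA.
Qed.

Variables (l : nat) (mu x : 'I_l -> nat) (T : 'I_l -> seq (seq nat)).
Hypothesis hT : forall i, has_2factorization (complete_mgraph (mu i * m) n) (T i).
Let isodd i := odd (mu i * m * n.-1).

Lemma assemble (chi : nat -> Q -> Q) (s : seq 'I_l) b0 :
  (forall b, part_preserving (chi b)) ->
  exists2 D,
    decomposes (flatten [seq flatten [seq nseq (x i) (scale_type m t) | t <- T i]
                        | i <- s]) D &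
    forall u v, D u v + \sum_(b < \sum_(i <- s | isodd i) x i)
                          std (chi (b0 + b) u) (chi (b0 + b) v) =
      mult (pairs_multipartite h m (\sum_(i <- s) x i * mu i)) u v.
Proof.
move=> chiP; elim: s b0 => [|i s IH] b0.
  exists (fun _ _ => 0) => // u v; rewrite !big_nil big_ord0 /=.
  by case: ifP.
have [B dB BE] := factors_over_pairs (hT i).
have [D dD DE] := IH (b0 + isodd i * x i).
have dBi := @decomposes_copies _ (fun c => chi (b0 + c)) (x i) _ _
              (fun c => (chiP (b0 + c)).1) dB.
have e : flatten [seq nseq (x i) (scale_type m t) | t <- T i] =
         flatten [seq nseq (x i) t | t <- [seq scale_type m t | t <- T i]].
  by rewrite -map_comp.
eexists; first by rewrite /= e; exact: decomposes_cat dBi dD.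
move=> u v /=.
have -> : \sum_(i <- i :: s | isodd i) x i =
          isodd i * x i + \sum_(i <- s | isodd i) x i.
  by rewrite big_cons; case: (isodd i); rewrite ?mul1n.
rewrite big_split_ord /= addnACA.
have -> : \sum_(c < isodd i * x i) std (chi (b0 + c) u) (chi (b0 + c) v) =
          \sum_(c < x i) isodd i * std (chi (b0 + c) u) (chi (b0 + c) v).
  case: (isodd i); last by rewrite big_ord0 big1.
  by rewrite mul1n; apply: eq_bigr => c _; rewrite mul1n.
(* Since [chi] preserves the parts, each relabelled copy together with what it leaves is again the
   complete multipartite graph. *)
rewrite -big_split /= (eq_bigr (fun=> mult (pairs_multipartite h m (mu i)) u v)); last first.
  move=> c _; rewrite BE /= !(chiP _).2 //.
under [X in _ + (_ + X)]eq_bigr => c _ do rewrite addnA.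
rewrite DE sum_nat_const card_ord big_cons /=.
by case: (_ != _); rewrite ?muln0.
Qed.

End Assembly.

Theorem theorem5p5 (n m l : nat)
    (hn : 0 < n) (hn_even : ~~ odd n) (hm : 0 < m) (hl : 0 < l)
    (mu : 'I_l -> nat) (hmu : forall i, 0 < mu i)
    (T : forall i : 'I_l, ((mu i * m * n.-1)./2).-tuple (seq nat))
    (hT : forall i, has_2factorization (complete_mgraph (mu i * m) n) (T i))
    (lambda : nat) (hlambda : 0 < lambda)
    (x : 'I_l -> nat) (hx : \sum_(i < l) x i * mu i = lambda) :
  let beta := \sum_(i < l | odd (mu i * m * n.-1)) x i in
  forall S : (beta./2).-tuple (seq nat),
    (forall j, admissible (complete_multipartite 2 n m) (tnth S j)) ->
    (forall j, bipartite_type (tnth S j)) ->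
    (forall j, refinement (tnth S j) (nseq n./2 (2 * m))) ->
  has_2factorization (complete_multipartite lambda n m)
    (flatten [seq flatten [seq nseq (x i) (scale_type m t) | t <- T i]
             | i <- enum 'I_l]
     ++ S).
Proof.
move=> beta S _ Sbip Sref.
have [|chi chiP dS] := @bipartite_factors n m S.
  by move=> t /tnthP[j ->].
have [D dD DE] := assemble hn hn_even hm x hT (enum 'I_l) 0 chiP.
have [phi [bij_phi partE]] := @rev_ord_leave n m hn hn_even hm.
have [f [fK phiK]] := bijP bij_phi.
have bf : bijective f by exists phi.
(* The leaves numbered 0 to [beta.-1] are used in pairs; for odd [beta] the last one remains as the
   1-factor. *)
pose G := pull (chi beta.-1 \o f) (std_factor n./2 m).
have := decomposes_pull bf (decomposes_cat dD dS).
move/(has_2factorization_decomposes (G := G) (b := odd beta)); apply.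
  have [g [chiK gK]] := bijP (chiP beta.-1).1.
  move=> u; rewrite /degree /=; set w := chi _ (f u).
  (* The only neighbour of [u]: flip the side in standard coordinates and map back. *)
  rewrite -[RHS](sum_eql (phi (g (w.1, ~~ w.2)))); apply: eq_bigr => v _.
  by rewrite stdE (can2_eq fK phiK) (can2_eq gK chiK).
move=> u v; rewrite /= size_tuple.
have := DE (f u) (f v); rewrite !big_enum hx -/beta /=.
have -> : part_of (f u) == part_of (f v) = (u.1 == v.1) by rewrite -partE !phiK.
move=> <-; rewrite -addnA; congr (_ + _).
have -> : \sum_(i <- enum 'I_l | odd (mu i * m * n.-1)) x i = beta by rewrite big_enum_cond.
exact: (sum_double_half beta (fun b => std (chi b (f u)) (chi b (f v)))).
Qed.
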